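(* Let $G$ be a connected graph of order $n$ and domination number $\gamma\le \frac{n+2}{3}$. Then $$\alpha(G)\ge \frac{8}{6n\gamma+18\gamma-9\gamma^2-4n}.$$
   Context: All graphs are finite and simple. For a graph $G$ on at least two vertices, $L(G)=D(G)-A(G)$ is its Laplacian matrix (degree matrix minus adjacency matrix), and the algebraic connectivity $\alpha(G)$ is the second smallest eigenvalue of $L(G)$ (counted with multiplicity); graphs are understood to have at least two vertices so that $\alpha(G)$ is defined. A set $S\subseteq V(G)$ is a dominating set if every vertex of $V(G)\setminus S$ is adjacent to at least one vertex of $S$; the domination number of $G$ is the minimum cardinality of a dominating set of $G$. *)

(* Defs.v *)
From HB Require Import structures.
From mathcomp Require Import all_boot all_order all_algebra.
From mathcomp Require Import polyrcf.

Set Implicit Arguments.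
Unset Strict Implicit.
Unset Printing Implicit Defensive.

Import Order.TTheory GRing.Theory Num.Theory.

Local Open Scope ring_scope.

(* A finite simple graph is a symmetric irreflexive relation e on a finite    *)
(* type T. Matrices are indexed by 'I_#|T| through the bijection enum_val.    *)

Section Laplacian.

Variables (R : pzRingType) (T : finType) (e : rel T).

Definition degree (x : T) : nat := #|[set y | e x y]|.

Definition adjacency_mx : 'M[R]_#|T| :=
  \matrix_(i, j) (e (enum_val i) (enum_val j))%:R.

Definition degree_mx : 'M[R]_#|T| :=
  diag_mx (\row_i (degree (enum_val i))%:R).

Definition laplacian_mx : 'M[R]_#|T| := degree_mx - adjacency_mx.

End Laplacian.

(* rootsR lists the distinct roots in R in strictly increasing order, so each *)
(* one is repeated according to its multiplicity. For a real symmetric matrix *)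
(* such as the Laplacian, all the eigenvalues are in R.                       *)
Definition spectrum (R : rcfType) (n : nat) (A : 'M[R]_n) : seq R :=
  flatten [seq nseq (mup x (char_poly A)) x | x <- rootsR (char_poly A)].

(* Indices start at 0; the default value 0 of nth is reached only if #|T| < 2. *)
Definition algebraic_connectivity (R : rcfType) (T : finType) (e : rel T) : R :=
  (spectrum (laplacian_mx R e))`_1.

Definition dominating (T : finType) (e : rel T) (D : {set T}) : bool :=
  [forall x, (x \notin D) ==> [exists y in D, e x y]].

(* [set: T] is dominating, so the minimum is taken over a nonempty family. *)
Definition domination_number (T : finType) (e : rel T) : nat :=
  #|[arg min_(D < [set: T] | dominating e D) #|D|]%N|.

(* Main.v *)
Require Import Defs.
From HB Require Import structures.
From mathcomp Require Import all_boot all_order all_algebra.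
From mathcomp Require Import polyrcf complex.
From mathcomp Require Import zify ring lra.

Set Implicit Arguments.
Unset Strict Implicit.
Unset Printing Implicit Defensive.

Import Order.TTheory GRing.Theory Num.Theory.

Local Open Scope ring_scope.

(** The bound holds for every eigenvalue lam having an eigenvector f orthogonal
    to the constants, and the bridge from there to the second smallest
    eigenvalue is the spectral theorem (second_eigenvalue_ge).

    Let p and q be vertices where f is largest and smallest; as f sums to zero,
    f p > 0 > f q. Summing the eigenvalue equation over a set S bounded below by
    a level of f gives cut_flow: lam * (sum of f over S) is the total drop of f
    along the edges leaving S, and all these drops are nonnegative. So a single
    edge leaving S drops by at most lam * (sum of f over S), hence by at most
    lam * f p * #|S| if S is on the positive side. Take a shortest path from p to q
    and let C be its vertex set. Between two consecutive values taken by f on C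
    some edge of the path descends, and the level set it leaves cannot contain
    the vertices of C further down. If the positive side has m vertices, c of
    them in C, adding these drops from p down to the lowest positive vertex of C
    gives (side_drop, side_drop_min)
      f p - (lowest value) <=
        lam * f p * (1 + (m - 1) + (m - 2) + ... + (m - (c - 2))),
    where the first drop counts only 1, being bounded by the cut around p alone.
    The same holds for - f on the other side. If x is the lowest positive and - y
    the highest nonpositive value on C, some edge crossing zero drops by x + y or
    more, so x + y is at most lam times f p or - f q times the size of the
    respective side.

    The bound being at most 1, assume lam < 1; this forces at least two vertices
    of C on each side. Sharing the gap x + y between the sides in the ratio x : y
    then yields
    2 * (1 - lam) <= lam * P1 * Q1 and 2 * (1 - lam) <= lam * P2 * Q2, where
    P1 + P2 = #|C| - 3 and Q1 + Q2 = 2 * #|T| - #|C| + 5. Multiplying these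
    and using 4 * x * y <= (x + y) ^ 2 twice eliminates the unknown sizes of the
    two sides (drop_balance). Finally a vertex of a dominating set dominates at
    most three vertices of a shortest path, so #|C| <= 3 * gamma
    (shortest_path_domination). The resulting bound
    8 / (8 + (#|C| - 3) * (2 * #|T| - #|C| + 5)) decreases in #|C| up to
    #|T| + 4, and the claimed one is its value with 3 * gamma + 1 in place of #|C|,
    which is where the hypothesis 3 * gamma <= #|T| + 2 enters. *)

(** * Shortest paths and domination *)

(** The only consequence of connectedness that the eigenvalue estimate needs:
    every cut separating two vertices of C is crossed by an edge inside C. *)
Definition crossing_connected (T : finType) (e : rel T) (C : {set T}) : Prop :=
  forall (S : {set T}) u v, u \in C -> v \in C -> u \in S -> v \notin S ->
    exists x y, [/\ x \in C :&: S, y \in C :\: S & e x y].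

Lemma path_crossing_connected (T : finType) (e : rel T) (p : T) (s : seq T) :
  symmetric e -> path e p s -> crossing_connected e [set x in p :: s].
Proof.
move=> e_sym eps S u v; rewrite !inE => uC vC uS vNS.
have [|] := boolP [exists x in [set x in p :: s] :&: S,
                    [exists y in [set x in p :: s] :\: S, e x y]].
  case/existsP=> x /andP[xC /existsP[y /andP[yC exy]]].
  by exists x, y.
move=> noedge; exfalso.
have const w : w \in p :: s -> (w \in S) = (p \in S).
  rewrite inE => /predU1P[->//|].
  elim: s p eps noedge {uC vC} => // z s IH p /= /andP[epz zs] noedge ws.
  have pz : (z \in S) = (p \in S).
    apply/idP/idP => H; apply: contraNT noedge => H'; apply/existsP.
      exists z; rewrite !inE eqxx orbT H; apply/existsP.
      by exists p; rewrite !inE eqxx H' e_sym.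
    exists p; rewrite !inE eqxx H; apply/existsP.
    by exists z; rewrite !inE eqxx orbT H'.
  move: ws; rewrite inE => /predU1P[->//|ws].
  rewrite -pz; apply: IH ws => //; apply: contra noedge.
  case/existsP=> x /andP[]; rewrite !inE => /andP[xs xS] /existsP[y].
  rewrite !inE => /andP[/andP[yS ys] exy].
  apply/existsP; exists x; rewrite !inE xs xS orbT; apply/existsP.
  by exists y; rewrite !inE ys yS orbT.
by move: vNS; rewrite const // -(const u) // uS.
Qed.

Section ShortestPath.
Variables (T : finType) (e : rel T).

Lemma shortest_path (p q : T) : connect e p q ->
  exists s, [/\ path e p s, last p s = q, uniq (p :: s) &
    forall s', path e p s' -> last p s' = q -> (size s <= size s')%N].
Proof.
case/connectP=> s0 ps0 q_last.
pose P k := [exists t : k.-tuple T, path e p t && (last p t == q)].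
have exP : exists k, P k.
  exists (size s0); apply/existsP; exists (in_tuple s0).
  by rewrite /= ps0 q_last eqxx.
have P_size s : path e p s -> last p s = q -> P (size s).
  by move=> ps qs; apply/existsP; exists (in_tuple s); rewrite /= ps qs eqxx.
case: (ex_minnP exP) => k /existsP[t /andP[pt /eqP qt]] kmin.
case: (shortenP pt) qt => s ps us sub qs.
exists s; split=> // s' ps' qs'.
apply: leq_trans (kmin _ (P_size _ ps' qs')).
rewrite -(size_tuple t).
by case/andP: us => _ us; exact: uniq_leq_size.
Qed.

Hypothesis e_sym : symmetric e.

Lemma shortcut (x y w : T) : (w == x) || e x w -> (w == y) || e y w ->
  exists r, [/\ path e x r, last x r = y & (size r <= 2)%N].
Proof.
case/predU1P=> [->|exw]; case/predU1P=> [<-|eyw].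
- by exists [::].
- by exists [:: y]; rewrite /= e_sym eyw.
- by exists [:: w]; rewrite /= exw.
- by exists [:: w; y]; rewrite /= exw e_sym eyw.
Qed.

(** If one vertex w dominated two vertices of the path at distance at least 3
    along it, going through w would shorten the path. So the vertices at
    positions 0, 3, 6, ... have distinct dominators. *)
Lemma shortest_path_domination (p : T) (s : seq T) (D : {set T}) :
  dominating e D -> path e p s ->
  (forall s', path e p s' -> last p s' = last p s -> (size s <= size s')%N) ->
  (size (p :: s) <= 3 * #|D|)%N.
Proof.
move=> /forallP domD ps smin.
have dom_ex x : exists w, (w \in D) && ((w == x) || e x w).
  have [xD|xND] := boolP (x \in D); first by exists x; rewrite xD eqxx.
  have := domD x; rewrite xND => /existsP[y /andP[yD exy]].
  by exists y; rewrite yD exy orbT.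
pose g x := xchoose (dom_ex x).
have gP x : (g x \in D) && ((g x == x) || e x (g x)) := xchooseP (dom_ex x).
pose v i := last p (take i s).
(* At most two steps through g (v i) would replace at least three. *)
have far i j : (i + 3 <= j <= size s)%N -> g (v i) <> g (v j).
  move=> ij gij.
  have [r [pr lr r2]] : exists r, [/\ path e (v i) r, last (v i) r = v j
                                    & (size r <= 2)%N].
    apply: (@shortcut _ _ (g (v i))); first by case/andP: (gP (v i)).
    by rewrite gij; case/andP: (gP (v j)).
  have pi : path e p (take i s).
    by move: ps; rewrite -{1}(cat_take_drop i s) cat_path => /andP[].
  have pj : path e (v j) (drop j s).
    by move: ps; rewrite -{1}(cat_take_drop j s) cat_path => /andP[].
  have := smin (take i s ++ r ++ drop j s).
  rewrite !cat_path pi -/(v i) pr lr pj !last_cat -/(v i) lr.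
  have -> : last (v j) (drop j s) = last p s.
    by rewrite -{2}(cat_take_drop j s) last_cat.
  move=> /(_ erefl erefl); rewrite !size_cat size_drop size_take_min.
  lia.
pose h (i : 'I_(size s %/ 3).+1) := g (v (i * 3)%N).
have h_inj : injective h.
  have lt_h (i j : 'I_(size s %/ 3).+1) : (i < j)%N -> h i <> h j.
    move=> ij; apply: far; have := ltn_ord j; lia.
  move=> i j hij; case: (ltngtP i j) => [ij|ji|ij].
  - by case: (lt_h i j ij hij).
  - by case: (lt_h j i ji (esym hij)).
  - exact: val_inj.
have : (#|[set h i | i in 'I_(size s %/ 3).+1]| <= #|D|)%N.
  apply/subset_leq_card/subsetP => _ /imsetP[i _ ->].
  by case/andP: (gP (v (i * 3)%N)).
rewrite card_imset // card_ord /=; lia.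
Qed.

End ShortestPath.

(** * Drops of an eigenfunction along edges *)

Section Eigenfunction.
Variables (R : realFieldType) (T : finType) (e : rel T).
Hypothesis e_sym : symmetric e.

Definition laplacian_eigenfunction (lam : R) (f : T -> R) : Prop :=
  forall u, \sum_(v | e u v) (f u - f v) = lam * f u.

Lemma laplacian_eigenfunctionN lam f :
  laplacian_eigenfunction lam f ->
  laplacian_eigenfunction lam (fun x => - f x).
Proof.
move=> fE u; rewrite mulrN -fE -sumrN.
by apply: eq_bigr => v _; ring.
Qed.

(** This covers both {f > t} and {f >= t}, so that the complement of an upper set
    for f is upper for - f and the two sides of a cut are treated alike. *)
Definition upper (f : T -> R) (S : {set T}) : Prop :=
  forall u v, u \in S -> v \notin S -> f v <= f u.

Lemma sum_subn_triangle (c m : nat) : (2 <= c <= m)%N ->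
  (\sum_(1 <= j < c.-1) (m - j))%N%:R
    = (c%:R - 2) * (2 * m%:R - c%:R + 1) / 2 :> R.
Proof.
case: c => [|[|c]] //=.
elim: c => [|c IH] cm; first by rewrite big_geq //; lra.
rewrite big_nat_recr //= natrD IH ?(ltnW cm) // natrB; last by lia.
by rewrite -(addn3 c) -(addn2 c) -(addn1 c) !natrD; field.
Qed.

Section Drop.
Variables (lam : R) (f : T -> R).
Hypothesis fE : laplacian_eigenfunction lam f.

(** Edges inside S contribute nothing, being counted once in each direction
    with opposite signs. *)
Lemma cut_flow (S : {set T}) :
  \sum_(u in S) \sum_(v | e u v && (v \notin S)) (f u - f v)
    = lam * \sum_(u in S) f u.
Proof.
rewrite mulr_sumr; under [RHS]eq_bigr do rewrite -fE (bigID (mem S)) /=.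
rewrite big_split /= -[LHS]add0r; congr (_ + _); apply/esym.
under eq_bigr do rewrite sumrB.
rewrite sumrB; apply/eqP; rewrite subr_eq0; apply/eqP.
rewrite [RHS](exchange_big_dep (mem S)) /=; last by move=> i j _ /andP[].
apply: eq_bigr => u uS.
by apply: eq_bigl => v; rewrite e_sym andbC uS andbT andbC.
Qed.

(** A single term of the flow through the cut, whose terms are nonnegative. *)
Lemma edge_drop (S : {set T}) u v : upper f S ->
  u \in S -> v \notin S -> e u v -> f u - f v <= lam * \sum_(w in S) f w.
Proof.
move=> upS uS vS euv; rewrite -cut_flow (bigD1 u) //= (bigD1 v) ?euv //=.
rewrite -addrA lerDl addr_ge0 //.
  by apply: sumr_ge0 => w /andP[/andP[_ wS] _]; rewrite subr_ge0; exact: upS.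
apply: sumr_ge0 => w /andP[wS _].
by apply: sumr_ge0 => z /andP[_ zS]; rewrite subr_ge0; exact: upS.
Qed.

Variables (C S : {set T}) (p : T).
Hypotheses (connC : crossing_connected e C) (upS : upper f S).
Hypotheses (pC : p \in C) (pmax : forall w, f w <= f p).
Hypotheses (lam_ge0 : 0 <= lam) (fp_ge0 : 0 <= f p).

(** The cut around p alone bounds the drop along one edge at p by lam * f p,
    whereas the level set of p could contain many vertices outside C. *)
Lemma peak_drop (U : {set T}) (q : T) : q \in C -> q \notin U -> p \in U ->
    (#|C :&: U| <= 1)%N ->
  exists y, [/\ y \in C, y \notin U & f p - f y <= lam * f p].
Proof.
move=> qC qU pU CU1.
have [x [y [xCU yCU exy]]] := connC pC qC pU qU.
have [yC yU] := setDP yCU.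
have xp : x = p.
  apply/eqP; apply: contraTT CU1 => xp; rewrite -ltnNge.
  by rewrite (cardsD1 p) inE pC pU (cardsD1 x) inE xCU inE xp.
exists y; split=> //; rewrite -[f p in leRHS](big_set1 +%R).
apply: edge_drop; rewrite ?set11 -?xp //.
  by move=> w z; rewrite inE => /eqP -> _; rewrite xp.
by rewrite inE; apply: contraNneq yU => ->; rewrite xp.
Qed.

(** Induction from the top of C downwards. To go from the next higher value f u1
    down to f u, some edge of C leaves U = {f > f u}. This set avoids the vertices
    of C :&: S counted by the lower bound r of the sum, so its size is at most
    #|S| - r. The top step is the one that peak_drop improves. *)
Lemma side_drop (u : T) : u \in C :&: S ->
  f p - f u <= lam * f p *
    (1 + \sum_(#|[set w in C :&: S | (f w <= f u)%R]| <= j < #|C :&: S|.-1)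
           (#|S| - j))%N%:R.
Proof.
have [k] := ubnP #|[set w in C | f u < f w]|.
elim: k u => // k IH u; rewrite ltnS => uk uCS.
have [uC uS] := setIP uCS.
set r := #|[set w in _ | _]|.
have lamp_ge0 : 0 <= lam * f p by rewrite mulr_ge0.
have [fpu|fup] := leP (f p) (f u).
  by apply: (@le_trans _ _ 0); rewrite ?subr_le0 // mulr_ge0 // ler0n.
pose U := [set w | f u < f w].
have upU : upper f U.
  by move=> x y; rewrite !inE -leNgt => ux yu; exact: le_trans yu (ltW ux).
have pU : p \in U by rewrite inE.
have uU : u \notin U by rewrite inE ltxx.
have US : U \subset S.
  apply/subsetP => w; rewrite inE => fuw; apply: contraLR fuw => wS.
  by rewrite -leNgt; exact: upS.
have card_above (X Y : {set T}) :
    X \subset U -> C :&: S \subset Y -> X \subset Y -> (r + #|X| <= #|Y|)%N.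
  move=> XU CSY XY; rewrite /r; set A := [set w in _ | _].
  have <- : #|A :|: X| = (#|A| + #|X|)%N.
    rewrite cardsU; suff -> : A :&: X = set0 by rewrite cards0 subn0.
    apply/setP=> w; rewrite !inE; case: leP; rewrite ?andbF //= => fwu.
    rewrite andbT; apply/negP => /andP[_ /(subsetP XU)].
    by rewrite inE ltNge fwu.
  apply/subset_leq_card; rewrite subUset XY andbT.
  by apply: subset_trans CSY; apply/subsetP => w; rewrite !inE => /andP[].
have disjCS : (r + #|C :&: U| <= #|C :&: S|)%N.
  by apply: card_above; rewrite ?subsetIr // setIS.
have disjS : (r + #|U| <= #|S|)%N by apply: card_above; rewrite ?subsetIr.
have pCU : p \in C :&: U by rewrite inE pC.
have [CU1|CU2] := leqP #|C :&: U| 1.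
  have [y [_ yU drop_p]] := peak_drop uC uU pU CU1.
  have fyu : f y <= f u by move: yU; rewrite inE -leNgt.
  apply: (@le_trans _ _ (f p - f y)); first by lra.
  apply: le_trans drop_p _; rewrite ler_peMr //.
  by rewrite natrD lerDl ler0n.
have [x [y [xCU yCU exy]]] := connC pC uC pU uU.
have [xC xU] := setIP xCU; have [yC yU] := setDP yCU.
have fyu : f y <= f u by move: yU; rewrite inE -leNgt.
have [u1 u1CU u1min] : exists2 u1, u1 \in C :&: U &
    forall w, w \in C :&: U -> f u1 <= f w.
  have := Order.TotalTheory.arg_minP (P := mem (C :&: U)) f pCU.
  by case=> u1; exists u1.
have [u1C u1U] := setIP u1CU.
have fuu1 : f u < f u1 by move: u1U; rewrite inE.
have u1S : u1 \in S := subsetP US _ u1U.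
have step : f u1 - f u <= lam * f p * (#|S| - r)%N%:R.
  apply: (@le_trans _ _ (f x - f y)); first by have := u1min _ xCU; lra.
  apply: le_trans (edge_drop upU xU yU exy) _.
  rewrite -mulrA ler_wpM2l //.
  apply: (@le_trans _ _ (\sum_(w in U) f p)); first by apply: ler_sum.
  rewrite sumr_const -[leLHS]mulr_natr ler_wpM2l // ler_nat leq_subRL //.
  exact: leq_trans (leq_addr _ _) disjS.
have lt1 : (#|[set w in C | (f u1 < f w)%R]| < k)%N.
  apply: leq_trans uk; apply/proper_card/properP; split.
    apply/subsetP=> w; rewrite !inE => /andP[-> H]; exact: lt_trans H.
  by exists u1; rewrite !inE u1C ?ltxx.
have := IH u1 lt1; rewrite inE u1C u1S => /(_ isT).
set r1 := #|[set w in _ | _]|.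
have rr1 : (r < r1)%N.
  apply/proper_card/properP; split.
    by apply/subsetP=> w; rewrite !inE => /andP[-> H]; exact: le_trans H (ltW _).
  by exists u1; rewrite !inE u1C u1S ?lexx // leNgt fuu1.
move=> drop1.
have le_sum : (1 + \sum_(r1 <= j < #|C :&: S|.-1) (#|S| - j) + (#|S| - r)
   <= 1 + \sum_(r <= j < #|C :&: S|.-1) (#|S| - j))%N.
  have r_lt : (r < #|C :&: S|.-1)%N.
    by rewrite ltn_predRL -addn2 (leq_trans _ disjCS) // leq_add2l.
  rewrite [X in (_ <= 1 + X)%N](big_ltn r_lt).
  rewrite -addnA leq_add2l addnC leq_add2l.
  have [le1|gt1] := leqP r1 #|C :&: S|.-1.
    by rewrite [leqRHS](big_cat_nat (n:=r1)) //= leq_addl.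
  by rewrite [leqLHS]big_geq // ltnW.
apply: le_trans (_ : (f p - f u1) + (f u1 - f u) <= _); first by lra.
apply: le_trans (lerD drop1 step) _.
by rewrite -mulrDr -natrD ler_wpM2l // ler_nat.
Qed.

(** The case of the lowest vertex of C :&: S. If C met S in p alone, the first
    drop would already reach a nonpositive value, so that f p <= lam * f p,
    against lam < 1. *)
Lemma side_drop_min (q : T) : q \in C -> q \notin S -> p \in S ->
    (forall w, w \notin S -> f w <= 0) -> 0 < f p -> lam < 1 ->
  (2 <= #|C :&: S|)%N /\
  exists u, [/\ u \in C :&: S, forall w, w \in C :&: S -> f u <= f w &
    f p - f u <= lam * f p *
      (1 + (#|C :&: S|%:R - 2) * (2 * #|S|%:R - #|C :&: S|%:R + 1) / 2)].
Proof.
move=> qC qS pS outS fp_gt0 lam_lt1.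
have pCS : p \in C :&: S by rewrite inE pC.
have c2 : (2 <= #|C :&: S|)%N.
  rewrite ltnNge; apply/negP => c1.
  have [y [_ yS drop_p]] := peak_drop qC qS pS c1.
  have := outS _ yS; nra.
split=> //.
have [u uCS umin] : exists2 u, u \in C :&: S &
    forall w, w \in C :&: S -> f u <= f w.
  have := Order.TotalTheory.arg_minP (P := mem (C :&: S)) f pCS.
  by case=> u; exists u.
exists u; split=> //; apply: le_trans (side_drop uCS) _.
rewrite ler_wpM2l ?mulr_ge0 // natrD lerD2l -sum_subn_triangle; last first.
  by rewrite c2 subset_leq_card // subsetIr.
rewrite ler_nat; set r := #|_|.
have r1 : (1 <= r)%N.
  by apply/card_gt0P; exists u; rewrite !inE -in_setI uCS lexx.
have [le1|gt1] := leqP r #|C :&: S|.-1.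
  by rewrite [leqRHS](big_cat_nat (n:=r)) //= leq_addl.
by rewrite [leqLHS]big_geq // ltnW.
Qed.

Lemma edge_drop_card (u v : T) : u \in S -> v \notin S -> e u v ->
  f u - f v <= lam * f p * #|S|%:R.
Proof.
move=> uS vS euv; apply: le_trans (edge_drop upS uS vS euv) _.
rewrite -mulrA ler_wpM2l // mulr_natr -sumr_const; exact: ler_sum.
Qed.

End Drop.

(** * Combining the two sides *)

(** Here m1, m2 are the sizes of the two sides, c1, c2 the numbers of vertices of
    the path on them, a, b the extreme values of f up to sign, and x, - y its
    values at the two ends of the gap around zero. *)
Lemma drop_balance (a b x y lam c1 c2 m1 m2 : R) :
  0 < a -> 0 < b -> 0 < x -> 0 <= y -> 0 <= lam < 1 ->
  2 <= c1 <= m1 -> 2 <= c2 <= m2 ->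
  a - x <= lam * a * (1 + (c1 - 2) * (2 * m1 - c1 + 1) / 2) ->
  b - y <= lam * b * (1 + (c2 - 2) * (2 * m2 - c2 + 1) / 2) ->
  x + y <= lam * a * m1 -> x + y <= lam * b * m2 ->
  8 <= lam * (8 + (c1 + c2 - 3) * (2 * (m1 + m2) - (c1 + c2) + 5)).
Proof.
move=> a0 b0 x0 y0 /andP[l0 l1] /andP[c1_2 c1m] /andP[c2_2 c2m] ha hb ca cb.
have xy0 : 0 < x + y by lra.
(* The fraction of the gap that lies on the positive side. *)
pose th := x / (x + y).
have xE : x = th * (x + y) by rewrite /th divfK // gt_eqF.
have yE : y = (1 - th) * (x + y) by rewrite mulrBl -xE; lra.
have th0 : 0 <= th by rewrite divr_ge0 // ltW.
have th1 : th <= 1 by rewrite /th ler_pdivrMr //; lra.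
clearbody th.
pose F (c m t : R) := 1 + (c - 2) * (2 * m - c + 1) / 2 + t * m.
(* F c m t collects the drops on a side together with a share t of the gap. FP
   bounds it by a product of two factors that are linear in c, m and t, as the
   AM-GM step needs; the two agree at t = 1. *)
have FP c m t : 2 <= c -> 0 <= t -> t <= 1 ->
    F c m t <= 1 + (c - 2 + t) * (2 * m - c - t + 3) / 2.
  move=> hc ht0 ht1; rewrite /F -subr_ge0.
  have -> : 1 + (c - 2 + t) * (2 * m - c - t + 3) / 2 -
    (1 + (c - 2) * (2 * m - c + 1) / 2 + t * m) =
    (1 - t) * (2 * (c - 1) - 2 + t) / 2 by field.
  by rewrite divr_ge0 // mulr_ge0; lra.
have lF1 : 1 <= lam * F c1 m1 th.
  rewrite -(ler_pM2l a0) mulr1.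
  have : x <= th * (lam * a * m1) by rewrite {1}xE ler_wpM2l.
  rewrite /F; lra.
have lF2 : 1 <= lam * F c2 m2 (1 - th).
  rewrite -(ler_pM2l b0) mulr1.
  have : y <= (1 - th) * (lam * b * m2) by rewrite {1}yE ler_wpM2l // subr_ge0.
  rewrite /F; lra.
set P1 := c1 - 2 + th; set Q1 := 2 * m1 - c1 - th + 3.
set P2 := c2 - 2 + (1 - th); set Q2 := 2 * m2 - c2 - (1 - th) + 3.
have h1 : 2 * (1 - lam) <= lam * (P1 * Q1).
  have := ler_wpM2l l0 (FP c1 m1 th c1_2 th0 th1); rewrite -/P1 -/Q1; lra.
have h2 : 2 * (1 - lam) <= lam * (P2 * Q2).
  have := ler_wpM2l l0 (FP c2 m2 (1 - th) c2_2 ltac:(lra) ltac:(lra)).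
  rewrite -/P2 -/Q2; lra.
have -> : c1 + c2 - 3 = P1 + P2 by rewrite /P1 /P2; ring.
have -> : 2 * (m1 + m2) - (c1 + c2) + 5 = Q1 + Q2 by rewrite /Q1 /Q2; ring.
have P10 : 0 <= P1 by rewrite /P1; lra.
have P20 : 0 <= P2 by rewrite /P2; lra.
have Q10 : 0 <= Q1 by rewrite /Q1; lra.
have Q20 : 0 <= Q2 by rewrite /Q2; lra.
clearbody P1 P2 Q1 Q2.
(* Multiply h1 by h2, and apply AM-GM to the P's and the Q's separately. *)
suff : 8 * (1 - lam) <= lam * ((P1 + P2) * (Q1 + Q2)) by lra.
rewrite -ler_sqr ?nnegrE; last 2 first.
- by rewrite mulr_ge0 //; lra.
- by rewrite !mulr_ge0 ?addr_ge0.
have h12 : (2 * (1 - lam)) ^+ 2 <= lam ^+ 2 * (P1 * P2 * (Q1 * Q2)).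
  have -> : lam ^+ 2 * (P1 * P2 * (Q1 * Q2))
    = lam * (P1 * Q1) * (lam * (P2 * Q2)) by ring.
  by rewrite expr2 ler_pM //; lra.
have agP : 4 * (P1 * P2) <= (P1 + P2) ^+ 2.
  by rewrite -subr_ge0 (_ : _ - _ = (P1 - P2) ^+ 2) ?sqr_ge0 //; ring.
have agQ : 4 * (Q1 * Q2) <= (Q1 + Q2) ^+ 2.
  by rewrite -subr_ge0 (_ : _ - _ = (Q1 - Q2) ^+ 2) ?sqr_ge0 //; ring.
have := ler_pM _ _ agP agQ; rewrite !mulr_ge0 // => /(_ isT isT) agPQ.
have := ler_wpM2l (sqr_ge0 lam) agPQ; rewrite !exprMn; lra.
Qed.

(** Both sides of the cut at zero are handled by side_drop_min, the lower one
    through the eigenfunction - f and the extremal vertex q. *)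
Lemma eigenvalue_ge_connected_set (lam : R) (f : T -> R) (C : {set T}) (p q : T) :
  laplacian_eigenfunction lam f -> \sum_x f x = 0 -> lam < 1 ->
  crossing_connected e C -> p \in C -> q \in C ->
  (forall w, f w <= f p) -> (forall w, f q <= f w) -> 0 < f p ->
  8 <= lam * (8 + (#|C|%:R - 3) * (2 * #|T|%:R - #|C|%:R + 5)).
Proof.
move=> fE sum0 lam_lt1 connC pC qC pmax qmin fp_gt0.
have lam_ge0 : 0 <= lam.
  rewrite -(pmulr_lge0 _ fp_gt0) -fE; apply: sumr_ge0 => v _.
  by rewrite subr_ge0.
have fq_lt0 : f q < 0.
  rewrite ltNge; apply: contraTN fp_gt0 => fq_ge0; rewrite -leNgt -sum0.
  rewrite (bigD1 p) //= lerDl; apply: sumr_ge0 => w _; exact: le_trans (qmin w).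
pose S := [set w | 0 < f w].
pose g w := - f w.
have gE : laplacian_eigenfunction lam g := laplacian_eigenfunctionN fE.
have inSC w : (w \in ~: S) = (f w <= 0) by rewrite !inE -leNgt.
have upS : upper f S.
  move=> u v; rewrite !inE -leNgt => uS vS; exact: le_trans vS (ltW uS).
have upSC : upper g (~: S).
  by move=> u v; rewrite !inSC -ltNge /g lerN2 => fu /ltW; exact: le_trans.
have gmax w : g w <= g q by rewrite lerN2.
have gq_gt0 : 0 < g q by rewrite oppr_gt0.
have pS : p \in S by rewrite inE.
have qSC : q \in ~: S by rewrite inSC ltW.
have qS : q \notin S by rewrite -in_setC.
have outS w : w \notin S -> f w <= 0 by rewrite -in_setC inSC.
have outSC w : w \notin ~: S -> g w <= 0.
  by rewrite inSC -ltNge oppr_le0 => /ltW.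
have pSC : p \notin ~: S by rewrite inSC -ltNge; move: pS; rewrite inE.
have [c1 [u [uCS umin du]]] := side_drop_min fE connC upS pC pmax lam_ge0
  (ltW fp_gt0) qC qS pS outS fp_gt0 lam_lt1.
have [c2 [v [vCS vmax dv]]] := side_drop_min gE connC upSC qC gmax lam_ge0
  (ltW gq_gt0) pC pSC qSC outSC gq_gt0 lam_lt1.
have [x [y [xCS yCS exy]]] := connC _ _ _ pC qC pS qS.
have [yC yS] := setDP yCS; have [xC xS] := setIP xCS.
have fux := umin _ xCS.
have fyv : f y <= f v.
  by rewrite -lerN2; apply: vmax; rewrite inE yC in_setC yS.
have dropS := edge_drop_card fE upS pmax lam_ge0 xS yS exy.
have xSC : x \notin ~: S by rewrite inSC -ltNge; move: xS; rewrite inE.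
have ySC : y \in ~: S by rewrite in_setC.
have dropSC : g y - g x <= _ :=
  edge_drop_card gE upSC gmax lam_ge0 ySC xSC (etrans (e_sym y x) exy).
have uS : 0 < f u by case/setIP: uCS => _; rewrite inE.
have vS : 0 <= g v by case/setIP: vCS => _; rewrite inSC oppr_ge0.
have cardC : #|C|%:R = #|C :&: S|%:R + #|C :&: ~: S|%:R :> R.
  by rewrite -natrD -setDE cardsID.
have cardT : #|T|%:R = #|S|%:R + #|~: S|%:R :> R by rewrite -natrD cardsC.
rewrite cardC cardT.
apply: (@drop_balance (f p) (g q) (f u) (g v)) => //.
- by rewrite lam_ge0.
- by rewrite !ler_nat c1 subset_leq_card // subsetIr.
- by rewrite !ler_nat c2 subset_leq_card // subsetIr.
- by apply: le_trans dropS; rewrite /g; lra.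
- by apply: le_trans dropSC; rewrite /g; lra.
Qed.

Lemma eigenvalue_ge_domination (lam : R) (f : T -> R) (s : R) :
  (forall x y, connect e x y) ->
  laplacian_eigenfunction lam f -> \sum_x f x = 0 -> (exists x, f x != 0) ->
  s = 3 * (domination_number e)%:R -> s <= #|T|%:R + 2 ->
  8 / (8 + (s - 2) * (2 * #|T|%:R - s + 4)) <= lam.
Proof.
move=> e_conn fE sum0 [x0 fx0] sE s_le.
have [p pmax] : exists p, forall w, f w <= f p.
  case: (@Order.TotalTheory.arg_maxP _ _ _ x0 predT f isT) => p _ pmax.
  by exists p => w; exact: pmax.
have [q qmin] : exists q, forall w, f q <= f w.
  case: (@Order.TotalTheory.arg_minP _ _ _ x0 predT f isT) => q _ qmin.
  by exists q => w; exact: qmin.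
have fp_gt0 : 0 < f p.
  rewrite ltNge; apply: contra fx0 => fp_le0.
  have f_le0 w : 0 <= - f w by rewrite oppr_ge0; exact: le_trans (pmax w) _.
  have : \sum_x - f x == 0 by rewrite sumrN sum0 oppr0.
  rewrite psumr_eq0 // => /allP/(_ x0); rewrite mem_index_enum oppr_eq0.
  exact.
have [t [pt lt ut tmin]] := shortest_path (e_conn p q).
have [D [domD cardD]] : exists D, dominating e D /\ #|D| = domination_number e.
  rewrite /domination_number; case: arg_minnP => [|D domD _]; last by exists D.
  by apply/forallP => x; rewrite inE.
have sizeC : #|[set x in p :: t]| = size (p :: t).
  by rewrite cardsE; exact/card_uniqP.
have C_le : #|[set x in p :: t]|%:R <= s.
  rewrite sizeC sE -natrM ler_nat -cardD.
  apply: (shortest_path_domination e_sym domD pt) => t' pt' lt'.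
  by apply: tmin => //; rewrite lt'.
have s_ge3 : 3 <= s.
  have : (0 < domination_number e)%N.
    have : (0 < size (p :: t))%N by [].
    rewrite -sizeC -(ltr_nat R) => /lt_le_trans/(_ C_le).
    by rewrite sE -natrM ltr_nat muln_gt0.
  by rewrite -(ler_nat R) sE; lra.
have den_ge8 : 0 <= (s - 2) * (2 * #|T|%:R - s + 4) by rewrite mulr_ge0 //; lra.
rewrite ler_pdivrMr; last by lra.
have [lam_lt1|lam_ge1] := ltP lam 1; last by nra.
have pC : p \in [set x in p :: t] by rewrite inE mem_head.
have qC : q \in [set x in p :: t] by rewrite inE -lt mem_last.
have bound := eigenvalue_ge_connected_set fE sum0 lam_lt1
  (path_crossing_connected e_sym pt) pC qC pmax qmin fp_gt0.
have lam_ge0 : 0 <= lam.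
  rewrite -(pmulr_lge0 _ fp_gt0) -fE; apply: sumr_ge0 => v _.
  by rewrite subr_ge0.
apply: le_trans bound _; rewrite ler_wpM2l // lerD2l -subr_ge0.
set c := _%:R in C_le *.
have -> : (s - 2) * (2 * #|T|%:R - s + 4) - (c - 3) * (2 * #|T|%:R - c + 5)
  = (s - c + 1) * (2 * #|T|%:R + 7 - s - c) by ring.
by rewrite mulr_ge0 //; lra.
Qed.

End Eigenfunction.

(** * The second eigenvalue of a symmetric matrix *)

Section Spectrum.
Variables (R : rcfType) (n : nat).
Implicit Types (A P : 'M[R]_n) (d : 'rV[R]_n).

Lemma sorted_spectrum A : sorted <=%R (spectrum A).
Proof.
rewrite /spectrum; set p := char_poly A; set r := rootsR p.
have : sorted <%R r by exact: sorted_roots.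
rewrite lt_sorted_pairwise (sorted_pairwise le_trans).
elim: r => //= x r IH /andP[xr sr]; rewrite pairwise_cat IH // andbT.
apply/andP; split.
  apply/allrelP => y z; rewrite mem_nseq => /andP[_ /eqP ->].
  case/flattenP => _ /mapP[w wr ->]; rewrite mem_nseq => /andP[_ /eqP ->].
  by rewrite ltW // (allP xr).
by elim: (mup x p) => //= k ->; rewrite andbT all_nseq lexx orbT.
Qed.

Lemma perm_spectrum A (ds : seq R) :
  char_poly A = \prod_(x <- ds) ('X - x%:P) -> perm_eq (spectrum A) ds.
Proof.
move=> charA; apply/allP => x _ /=; apply/eqP.
rewrite -[RHS]mu_prod_XsubC -charA /spectrum; set p := char_poly A.
have p_neq0 : p != 0 by rewrite monic_neq0 // char_poly_monic.
have r_uniq : uniq (rootsR p) by apply: lt_sorted_uniq; exact: sorted_roots.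
rewrite count_flatten sumnE !big_map.
under eq_bigr => y _ do rewrite count_nseq /= eq_sym.
have [px|npx] := boolP (root p x); last first.
  rewrite mupNroot // big1_seq // => y /andP[_ yr].
  have := roots_on_rootsR p_neq0 y; rewrite yr /= => py.
  by case: eqVneq => [xy|_]; rewrite ?mul0n // xy py in npx.
have xr : x \in rootsR p by rewrite -roots_on_rootsR // px.
rewrite (bigD1_seq x) //= eqxx mul1n big1 ?addn0 // => y.
by rewrite eq_sym => /negPf ->.
Qed.

(** Over R[i] the matrix is Hermitian, hence unitarily diagonalizable with real
    eigenvalues; two real matrices similar over R[i] are similar over R. *)
Lemma symmetric_diagonalizable A : A^T = A ->
  exists P d, P \in unitmx /\ P *m A = diag_mx d *m P.
Proof.
move=> A_sym; pose toC := real_complex R; pose AC := map_mx toC A.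
have AC_real : AC \is a mxOver Num.real.
  by apply/mxOverP => i j; rewrite !mxE complex_real.
have AC_herm : AC \is hermsymmx.
  apply: realsym_hermsym => //; apply/is_hermitianmxP.
  by rewrite expr0 scale1r map_mx_id // map_trmx A_sym.
have [sp_real AC_spec] : spectral_diag AC \is a mxOver Num.real /\
    AC = invmx (spectralmx AC) *m diag_mx (spectral_diag AC) *m spectralmx AC.
  split; first exact: hermitian_spectral_diag_real.
  exact/orthomx_spectralP/hermitian_normalmx.
have D_real : diag_mx (spectral_diag AC) \is a mxOver Num.real.
  apply/mxOverP => i j; rewrite mxE; case: eqP => _; last exact: rpred0.
  by have /mxOverP := sp_real; exact.
have simAD : simmx_in unitmx AC (diag_mx (spectral_diag AC)).
  exists (spectralmx AC); first exact: spectral_unit.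
  apply/simmxP; rewrite ?spectral_unit // {2}AC_spec !mulmxA.
  by rewrite mulmxV ?mul1mx // spectral_unit.
have [Q] := real_similar simAD AC_real D_real.
rewrite !inE => /andP[Q_real Q_unit] /(simmxP Q_unit) QA.
have toR m k (M : 'M[R[i]]_(m, k)) : M \is a mxOver Num.real ->
    map_mx toC (map_mx (@complex.Re R) M) = M.
  move/mxOverP => M_real; apply/matrixP => i j; rewrite !mxE.
  exact: RRe_real.
exists (map_mx (@complex.Re R) Q), (map_mx (@complex.Re R) (spectral_diag AC)).
split; first by rewrite -(map_unitmx toC) toR.
apply: (map_mx_inj (f := toC)); rewrite !map_mxM map_diag_mx !toR //.
Qed.

Lemma char_poly_diagonalizable A P d : P \in unitmx ->
  P *m A = diag_mx d *m P ->
  char_poly A = \prod_(x <- [seq d 0 i | i <- enum 'I_n]) ('X - x%:P).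
Proof.
move=> P_unit PA; rewrite big_map big_enum /=.
have -> : \prod_i ('X - (d 0 i)%:P) = char_poly (diag_mx d).
  rewrite char_poly_trig ?diag_mx_is_trig //.
  by apply: eq_bigr => i _; rewrite mxE eqxx.
have detP_neq0 : \det (map_mx polyC P) != 0.
  by rewrite det_map_mx polyC_eq0 -unitfE -unitmxE.
apply: (mulfI detP_neq0); rewrite -det_mulmx mulrC -det_mulmx.
congr (\det _); rewrite mulmxBr mulmxBl -!map_mxM PA.
by rewrite scalar_mxC.
Qed.

Lemma row_eigenvector A P d (k : 'I_n) :
  P *m A = diag_mx d *m P -> row k P *m A = d 0 k *: row k P.
Proof.
by move=> PA; rewrite !rowE -mulmxA PA mulmxA -rowE row_diag_mx scalemxAl.
Qed.

Lemma mulmx_unit_neq0 P (c : 'rV[R]_n) : P \in unitmx -> c != 0 -> c *m P != 0.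
Proof. by move=> P_unit; rewrite mulmx_free_eq0 // row_free_unit. Qed.

Lemma delta_mx_neq0 (k : 'I_n) : delta_mx 0 k != 0 :> 'rV[R]_n.
Proof. by apply/eqP => /rowP/(_ k)/eqP; rewrite !mxE !eqxx oner_eq0. Qed.

(** A repeated eigenvalue has an eigenspace of dimension at least 2, which meets
    every hyperplane. *)
Lemma eigenvector_orthogonal A P d (u : 'cV[R]_n) (i j : 'I_n) :
  P \in unitmx -> P *m A = diag_mx d *m P -> i != j -> d 0 i = d 0 j ->
  exists w : 'rV[R]_n, [/\ w != 0, w *m A = d 0 i *: w & w *m u = 0].
Proof.
move=> P_unit PA ij dij; pose a k := (row k P *m u) 0 0.
have uE k : row k P *m u = (a k)%:M by exact: mx11_scalar.
have [ai0|ai_neq0] := eqVneq (a i) 0.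
  exists (row i P); rewrite (row_eigenvector i PA) uE ai0 raddf0; split=> //.
  by rewrite rowE mulmx_unit_neq0 // delta_mx_neq0.
exists (a i *: row j P - a j *: row i P); split.
- rewrite !rowE !scalemxAl -mulmxBl mulmx_unit_neq0 //.
  apply: contra_neq ai_neq0 => /rowP/(_ j); rewrite !mxE !eqxx mulr1.
  by rewrite [j == i]eq_sym (negPf ij) mulr0 subr0.
- rewrite mulmxBl -!scalemxAl (row_eigenvector i PA) (row_eigenvector j PA).
  by rewrite -dij scalerBr !scalerA ![d 0 i * _]mulrC.
- by rewrite mulmxBl -!scalemxAl !uE !scale_scalar_mx [a j * _]mulrC subrr.
Qed.

(** An eigenvector for a nonzero eigenvalue is orthogonal to the null vector u
    since A is symmetric. So if two entries of the spectrum were below B, both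
    would be 0, and the eigenspace of 0 would contain an eigenvector orthogonal
    to u, against the hypothesis. *)
Lemma second_eigenvalue_ge A (u : 'cV[R]_n) (B : R) :
  A^T = A -> A *m u = 0 -> (2 <= n)%N ->
  (forall (w : 'rV[R]_n) b,
     w != 0 -> w *m A = b *: w -> w *m u = 0 -> B <= b) ->
  B <= (spectrum A)`_1.
Proof.
move=> A_sym Au n2 ge_B.
have [P [d [P_unit PA]]] := symmetric_diagonalizable A_sym.
have perm_d := perm_spectrum (char_poly_diagonalizable P_unit PA).
rewrite leNgt; apply/negP => lt_B.
have : (1 < count [pred x | (x < B)%R] (spectrum A))%N.
  have := perm_size perm_d; rewrite size_map -cardE card_ord.
  case: (spectrum A) (sorted_spectrum A) lt_B => [|x [|y s]] /=;
    try by move=> _ _ n_small; rewrite -n_small in n2.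
  by move=> /andP[xy _] yB _; rewrite yB (le_lt_trans xy yB).
rewrite (permP perm_d) count_map.
have -> : count (preim (d 0) [pred x | x < B]) (enum 'I_n) =
    #|[pred i | d 0 i < B]|.
  by rewrite cardE enumT [in RHS]/enum_mem size_filter.
move=> /card_gt1P[i [j [iB jB ij]]]; rewrite !inE in iB jB.
have d0 k : d 0 k < B -> d 0 k = 0.
  move=> kB; apply/eqP; apply: contraTT kB => dk; rewrite -leNgt.
  have wA := row_eigenvector k PA; apply: (ge_B (row k P)) => //.
    by rewrite rowE mulmx_unit_neq0 // delta_mx_neq0.
  by apply: (scalerI dk); rewrite scaler0 scalemxAl -wA -mulmxA Au mulmx0.
have dij : d 0 i = d 0 j by rewrite (d0 i iB) (d0 j jB).
have [w [w0 wA wu]] := eigenvector_orthogonal u P_unit PA ij dij.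
by have := ge_B w _ w0 wA wu; rewrite leNgt iB.
Qed.

End Spectrum.

(** * The Laplacian *)

Section Laplacian.
Variables (R : rcfType) (T : finType) (e : rel T).
Hypothesis e_sym : symmetric e.

Lemma laplacian_mx_sym : (laplacian_mx R e)^T = laplacian_mx R e.
Proof.
rewrite /laplacian_mx linearB /= tr_diag_mx; congr (_ - _).
by apply/matrixP => i j; rewrite !mxE e_sym.
Qed.

Lemma mul_laplacian_mx (w : 'rV[R]_#|T|) (x : T) :
  (w *m laplacian_mx R e) 0 (enum_rank x) =
    \sum_(y | e x y) (w 0 (enum_rank x) - w 0 (enum_rank y)).
Proof.
rewrite /laplacian_mx mulmxBr mxE sumrB; congr (_ + _).
  rewrite mul_mx_diag !mxE enum_rankK sumr_const mulr_natr.
  by congr (_ *+ _); apply: eq_card => y; rewrite inE.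
rewrite !mxE; congr (- _).
rewrite (reindex enum_rank) /=; last first.
  by exists enum_val => y _; rewrite ?enum_rankK ?enum_valK.
rewrite [RHS]big_mkcond; apply: eq_bigr => y _.
by rewrite mxE !enum_rankK e_sym; case: (e x y); rewrite ?mulr1 ?mulr0.
Qed.

Lemma laplacian_mx_const : laplacian_mx R e *m (const_mx 1 : 'cV_#|T|) = 0.
Proof.
apply: trmx_inj; rewrite trmx_mul laplacian_mx_sym trmx_const trmx0.
apply/rowP => i; rewrite -(enum_valK i) mul_laplacian_mx [RHS]mxE.
by apply: big1 => y _; rewrite !mxE subrr.
Qed.

Lemma laplacian_mx_eigenfunction (w : 'rV[R]_#|T|) (b : R) :
  w *m laplacian_mx R e = b *: w ->
  laplacian_eigenfunction e b (fun x => w 0 (enum_rank x)).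
Proof. by move=> wL x; rewrite -mul_laplacian_mx wL mxE. Qed.

End Laplacian.

Theorem corollary3p11 (R : rcfType) (T : finType) (e : rel T) (n gamma : nat)
    (e_sym : symmetric e) (e_irr : irreflexive e)
    (e_conn : forall x y : T, connect e x y)
    (n_order : n = #|T|) (n_ge2 : (2 <= n)%N)
    (gamma_dom : gamma = domination_number e)
    (gamma_le : gamma%:R <= (n%:R + 2) / 3 :> R) :
  8 / (6 * n%:R * gamma%:R + 18 * gamma%:R - 9 * gamma%:R ^+ 2 - 4 * n%:R)
    <= algebraic_connectivity R e.
Proof.
rewrite n_order in n_ge2 gamma_le *; rewrite gamma_dom in gamma_le *.
apply: (second_eigenvalue_ge (laplacian_mx_sym R e_sym)
          (laplacian_mx_const R e_sym) n_ge2) => w b w0 wL w1.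
have sum0 : \sum_x w 0 (enum_rank x) = 0.
  move/matrixP/(_ 0 0): w1; rewrite !mxE => sum1; rewrite -[RHS]sum1.
  rewrite [RHS](reindex enum_rank) /=.
    by apply: eq_bigr => x _; rewrite mxE mulr1.
  by exists enum_val => y _; rewrite ?enum_rankK ?enum_valK.
have [x wx] : exists x, w 0 (enum_rank x) != 0.
  have /rV0Pn[i wi] := w0; by exists (enum_val i); rewrite enum_valK.
have := eigenvalue_ge_domination e_sym e_conn (laplacian_mx_eigenfunction e_sym wL)
  sum0 (ex_intro _ x wx) erefl.
set g := (domination_number e)%:R in gamma_le *; set m := #|T|%:R in gamma_le *.
have -> : 8 + (3 * g - 2) * (2 * m - 3 * g + 4) =
  6 * m * g + 18 * g - 9 * g ^+ 2 - 4 * m by ring.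
by apply; lra.
Qed.
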